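(* Let $d\ge 3$ be an odd integer and suppose that $d=r+s$ for some integers $1\le s<r$. Suppose that $\alpha\neq\beta$ in $\mathbb{T}$ satisfy Condition (P) (with respect to $r,s$), and set $d_0=\frac{d-1}{2}$. Let $V:=\alpha I_r\oplus\beta I_s\in\mathcal{U}(\mathbb{C}^d)$. The following statements are equivalent: (a) $V\in\mathrm{Sym}_3(\mathbb{C}^d)$. (b) $r=d_0+1$, $s=d_0$, and $|1-(\alpha\beta)^{2j-1}|<|\alpha-\beta|$ for all $1\le j\le d_0$.
   Context: $\mathbb{T}=\{z\in\mathbb{C}:|z|=1\}$; $\mathcal{U}(\mathbb{C}^d)$ is the group of unitary $d\times d$ matrices. A symmetry on $\mathbb{C}^d$ is an operator $J$ with $J=J^*=J^{-1}$. $\mathrm{Sym}_k(\mathbb{C}^d)$ is the set of all products $J_1J_2\cdots J_k$ of $k$ symmetries on $\mathbb{C}^d$. Condition (P): for $d=r+s$ with integers $1\le s\le r$, the numbers $\alpha\ne\beta\in\mathbb{T}$ satisfy Condition (P) if (i) $\alpha^r\beta^s\in\{-1,1\}$, and (ii) whenever $i,j\ge 0$ are integers, not both zero, with $\alpha^i\beta^j\in\{-1,1\}$, then $i+j\ge d$. (In particular $\alpha,\beta\notin\{-1,1\}$.) *)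

(* Defs.v *)
From mathcomp Require Import all_boot all_order all_algebra.
From mathcomp Require Export reals.
From mathcomp Require Export complex.

Set Implicit Arguments.
Unset Strict Implicit.
Unset Printing Implicit Defensive.

Import GRing.Theory Num.Theory Num.Def.
Local Open Scope ring_scope.
Local Open Scope sesquilinear_scope.

(* The invertibility clause is needed because invmx J = J by convention when
   J is not invertible. *)
Definition is_symmetry (C : numClosedFieldType) (d : nat) (J : 'M[C]_d) : Prop :=
  [/\ J \in unitmx, J = J ^t* & J = invmx J].

Definition Sym (C : numClosedFieldType) (k d : nat) (A : 'M[C]_d) : Prop :=
  exists J : 'I_k -> 'M[C]_d,
    (forall i, is_symmetry (J i)) /\ A = \prod_(i < k) J i.

(* The remaining requirements (1 <= s <= r, a != b, |a| = |b| = 1) are imposed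
   separately where this predicate is used. *)
Definition ConditionP (C : numClosedFieldType) (r s : nat) (a b : C) : Prop :=
  a ^+ r * b ^+ s \in [:: -1; 1] /\
  (forall i j : nat, ~ (i = 0%N /\ j = 0%N) ->
     a ^+ i * b ^+ j \in [:: -1; 1] -> (r + s <= i + j)%N).

(* Main.v *)
(* V = J1 J2 J3 means that W = J1 V = J2 J3, so the spectrum of W carries two
   involutions: l |-> 1/l (conjugation by J3 inverts J2 J3) and, because V has
   only the two eigenvalues a and b, l |-> -ab/l.  Both preserve multiplicities,
   the second one as long as l is not +-a or +-b.

   As r > d/2, some eigenspace of J1 meets ker(V - a) in dimension at least
   r - d0, on which W = +-a.  Alternating the two involutions from +-a produces
   d0 + 1 eigenvalues of multiplicity at least r - d0, and Condition (P) says
   both that the exceptional values are avoided and that these eigenvalues are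
   distinct; hence r = d0 + 1.  The inequalities of (b) say that the
   two-dimensional blocks spanned by y and y J1 do not degenerate.

   Conversely, prescribe the spectrum of J2 J3 to be such a chain, closed off by
   the real number +-a^(d0+1) b^d0.  The inequalities allow J1 to be built from
   plane reflections so that J1 J2 J3 has quadratic polynomial (x - a)(x - b) and
   the trace of V, which makes it unitarily similar to V. *)
From mathcomp Require Import all_boot fingroup perm.
Require Import Defs.
From mathcomp Require Import all_boot all_order all_algebra.
From mathcomp Require Import reals complex.
From mathcomp Require Import ring zify.

Set Implicit Arguments.
Unset Strict Implicit.
Unset Printing Implicit Defensive.

Import Order.TTheory GRing.Theory Num.Theory.
Local Open Scope ring_scope.
Local Open Scope sesquilinear_scope.

(** * Complex numbers of modulus 1 *)

Section Unimodular.
Variable C : numClosedFieldType.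
Implicit Types a b l : C.

Lemma unimodular_neq0 a : `|a| = 1 -> a != 0.
Proof. by move=> ha; rewrite -normr_eq0 ha oner_neq0. Qed.

Lemma conjC_unimodular a : `|a| = 1 -> a^* = a^-1.
Proof. by move=> ha; rewrite invC_norm ha expr1n invr1 mul1r. Qed.

Lemma normC_sum_diff a b : `|a| = 1 -> `|b| = 1 ->
  `|a - b| ^+ 2 = 4 - `|a + b| ^+ 2.
Proof.
move=> ha hb; rewrite !normCK !rmorphD rmorphN /= !conjC_unimodular //.
by field; rewrite !unimodular_neq0.
Qed.

(** By the parallelogram law; the right-hand form says that [(a + b) / (l1 - l2)] can serve as a
    cosine. *)
Lemma ltr_normC_diff a b l1 l2 : `|a| = 1 -> `|b| = 1 -> `|l1| = 1 -> `|l2| = 1 ->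
  (`|l1 + l2| < `|a - b|) = (`|a + b| < `|l1 - l2|).
Proof.
move=> ha hb h1 h2.
rewrite -[LHS]ltr_sqr ?nnegrE // -[RHS]ltr_sqr ?nnegrE // !normC_sum_diff //.
by rewrite ltrBrDr ltrBrDr addrC.
Qed.

End Unimodular.

(** * Adjoints, symmetries and products of three symmetries *)

Section Adjoint.
Variable C : numClosedFieldType.

Lemma adjB m n (A B : 'M[C]_(m, n)) : (A - B)^t* = A^t* - B^t*.
Proof. by apply/matrixP=> i j; rewrite !mxE rmorphB. Qed.

Lemma adjZ m n (c : C) (A : 'M[C]_(m, n)) : (c *: A)^t* = c^* *: A^t*.
Proof. by apply/matrixP=> i j; rewrite !mxE rmorphM. Qed.

Lemma adjM m n p (A : 'M[C]_(m, n)) (B : 'M[C]_(n, p)) :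
  (A *m B)^t* = B^t* *m A^t*.
Proof. by rewrite trmx_mul map_mxM. Qed.

Lemma sqnorm_gt0 n (u : 'rV[C]_n) : u != 0 -> 0 < (u *m u^t*) 0 0.
Proof. by move=> /dotmx_is_dotmx; rewrite dotmxE. Qed.

Lemma symmetryP n (J : 'M[C]_n) : is_symmetry J <-> J^t* = J /\ J *m J = 1%:M.
Proof.
split=> [[uJ JJ Ji]|[JJ J2]].
  by rewrite -JJ; split=> //; rewrite {2}Ji mulmxV.
have [uJ _] := mulmx1_unit J2; split=> //.
by rewrite -[LHS]mulmx1 -(mulmxV uJ) mulmxA J2 mul1mx.
Qed.

Lemma symmetry_unitary n (J : 'M[C]_n) : is_symmetry J -> J \is unitarymx.
Proof. by case/symmetryP=> JJ J2; apply/unitarymxP; rewrite JJ. Qed.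

Lemma Sym3P n (A : 'M[C]_n) :
  Sym 3 A <-> exists J1 J2 J3, [/\ is_symmetry J1, is_symmetry J2,
    is_symmetry J3 & A = J1 *m J2 *m J3].
Proof.
split=> [[J [sJ ->]]|[J1 [J2 [J3 [s1 s2 s3 ->]]]]].
  exists (J 0), (J 1), (J (lift 0 1)); split=> //.
  rewrite !big_ord_recl big_ord0 mulr1 mulrA /=.
  by congr (_ *m J _ *m J _); apply/val_inj.
exists (fun i : 'I_3 => if i == 0 :> nat then J1 else if i == 1 :> nat then J2 else J3).
split; first by case=> [[|[|[|i]]]].
by rewrite !big_ord_recl big_ord0 mulr1 mulrA.
Qed.

End Adjoint.

(** * Eigenvectors of [J *m V] for a unitary [V] with a quadratic equation *)

Section TwoBlock.
Variables (C : numClosedFieldType) (n : nat) (a b : C) (J V : 'M[C]_n).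
Hypotheses (a1 : `|a| = 1) (b1 : `|b| = 1).
Hypotheses (sJ : is_symmetry J) (uV : V \is unitarymx).
Hypothesis qV : V *m V = (a + b) *: V - (a * b)%:M.

(** Multiply the quadratic relation by [E *m J]. Hence the span of [E] and [E *m J] is stable under
    [V]. *)
Lemma mul_quadratic m (E : 'M[C]_(m, n)) l : l != 0 -> E *m J *m V = l *: E ->
  E *m V = (a + b) *: E - (a * b / l) *: (E *m J).
Proof.
move=> l0 EJV; apply: (scalerI l0).
have := congr1 (mulmx (E *m J)) qV.
rewrite mulmxA EJV -scalemxAl => ->.
rewrite mulmxBr mul_mx_scalar -scalemxAr EJV.
apply/matrixP=> i j; rewrite !mxE; field; exact: l0.
Qed.

(** The hypotheses make [l ^+ 2] an eigenvalue of [V *m V] on [y], but only [a ^+ 2] and [b ^+ 2]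
    are possible. Concretely, [h] and its image [h2] under [V] relate [y] and [y *m J]; eliminating
    the latter leaves the factor [(l ^+ 2 - a ^+ 2) * (l ^+ 2 - b ^+ 2)]. *)
Lemma eq0_of_transfer m (y : 'M[C]_(m, n)) l : l ^+ 2 != a ^+ 2 -> l ^+ 2 != b ^+ 2 ->
  y *m J *m V = l *: y -> y *m V = l *: (y *m J) -> y = 0.
Proof.
move=> la lb yJV yV.
have yV2 : y *m V *m V = l ^+ 2 *: y by rewrite yV -scalemxAl yJV scalerA.
have h : ((a + b) * l) *: (y *m J) = (l ^+ 2 + a * b) *: y.
  rewrite -scalerA -yV; move: yV2; rewrite -mulmxA qV mulmxBr -scalemxAr mul_mx_scalar.
  by rewrite scalerDl => <-; rewrite subrK.
have h2 : ((a + b) * l ^+ 2) *: y = ((l ^+ 2 + a * b) * l) *: (y *m J).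
  have := congr1 (mulmx^~ V) h; rewrite /= -!scalemxAl yJV yV !scalerA.
  by rewrite -mulrA -expr2.
have : ((l ^+ 2 - a ^+ 2) * (l ^+ 2 - b ^+ 2)) *: y = 0.
  have -> : (l ^+ 2 - a ^+ 2) * (l ^+ 2 - b ^+ 2) =
     (l ^+ 2 + a * b) * (l ^+ 2 + a * b) - (a + b) * ((a + b) * l ^+ 2) by ring.
  rewrite scalerBl -[in X in X - _]scalerA -h -[in X in _ - X]scalerA h2 !scalerA.
  by rewrite -scalerBl; apply/eqP; rewrite scaler_eq0; apply/orP; left; apply/eqP; ring.
by move/eqP; rewrite scaler_eq0 mulf_eq0 !subr_eq0 (negPf la) (negPf lb) => /eqP.
Qed.

(* [E *m (V - l *: J)] consists of eigenvectors for [- (a * b) / l], and the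
   restrictions on [l] make this map injective on the eigenspace of [l]. *)
Lemma rank_eigenspace_transfer l : l != 0 -> l ^+ 2 != a ^+ 2 -> l ^+ 2 != b ^+ 2 ->
  (\rank (eigenspace (J *m V) l) <= \rank (eigenspace (J *m V) (- (a * b) / l)))%N.
Proof.
move=> l0 la lb; have [_ J2] := (symmetryP J).1 sJ.
set E := eigenspace _ l.
have EJV : E *m J *m V = l *: E by rewrite -mulmxA; apply/eigenspaceP.
have EV := mul_quadratic l0 EJV.
have <- : \rank (E *m (V - l *: J)) = \rank E.
  apply/eqP; rewrite -[X in _ == X](mxrank_mul_ker E (V - l *: J)) -[X in X == _]addn0.
  rewrite eqn_add2l eq_sym mxrank_eq0; apply/rowV0P => y.
  rewrite sub_capmx => /andP[/eigenspaceP yE /sub_kermxP].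
  rewrite mulmxBr -scalemxAr => /eqP; rewrite subr_eq0 => /eqP yV.
  by apply: eq0_of_transfer la lb _ yV; rewrite -mulmxA.
apply/mxrankS/eigenspaceP.
rewrite mulmxBr -scalemxAr EV mulmxA !mulmxBl -!scalemxAl.
rewrite -[E *m J *m J]mulmxA J2 mulmx1 EJV EV.
apply/matrixP=> i j; rewrite !mxE; field; exact: l0.
Qed.

(* The squared norm of [x = y *m (V - l *: J)] turns out to be
   (|l + a b / l|^2 - |a + b|^2) |y|^2, so the gap is [x != 0] rephrased. *)
Lemma eigen_gap (y : 'rV[C]_n) l : `|l| = 1 -> l ^+ 2 != a ^+ 2 -> l ^+ 2 != b ^+ 2 ->
  y != 0 -> y *m J *m V = l *: y -> `|l - a * b / l| < `|a - b|.
Proof.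
move=> l1 la lb y0 yJV; have [JJ J2] := (symmetryP J).1 sJ.
have l0 := unimodular_neq0 l1; have yV := mul_quadratic l0 yJV.
have [a0 b0] := (unimodular_neq0 a1, unimodular_neq0 b1).
have q1 : `|a * b / l| = 1 by rewrite !normrM normfV a1 b1 l1 invr1 !mulr1.
set x := y *m V - l *: (y *m J).
have x0 : x != 0.
  apply: contra_neq y0 => /eqP; rewrite subr_eq0 => /eqP xE.
  exact: eq0_of_transfer la lb yJV xE.
set N := (y *m y^t*) 0 0; set h := (y *m J *m y^t*) 0 0.
have N0 : 0 < N by exact: sqnorm_gt0.
have formE p q : ((p *: y - q *: (y *m J)) *m (p *: y - q *: (y *m J))^t*) 0 0 =
    (p * p^* + q * q^*) * N - (p * q^* + p^* * q) * h.
  rewrite adjB !adjZ adjM JJ !mulmxBl !mulmxBr -!scalemxAl -!scalemxAr.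
  rewrite !mulmxA -[y *m J *m J]mulmxA J2 mulmx1 /N /h.
  by move: (y *m y^t*) (y *m J *m y^t*) => Y Z; rewrite !mxE; ring.
(* Unitarity of [V] yields a linear relation between [N] and [h], which eliminates [h] from the
   squared norm of [x]. *)
have : ((y *m V) *m (y *m V)^t*) 0 0 = N.
  by rewrite adjM mulmxA -[y *m V *m _]mulmxA (unitarymxP uV) mulmx1.
rewrite yV formE => e1.
have := sqnorm_gt0 x0; rewrite /x yV -addrA -opprD -scalerDl formE => e2.
rewrite ltr_normC_diff ?normrN // opprK -ltr_sqr ?nnegrE // -subr_gt0 -(pmulr_lgt0 _ N0).
move: e1 e2; rewrite !normCK !rmorphD /= !conjC_unimodular //.
move: (N) (h) => u v e1; rewrite [l + _]addrC [l^-1 + _]addrC.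
suff -> : ((a * b / l + l) * ((a * b / l)^-1 + l^-1) - (a + b) * (a^-1 + b^-1)) * u =
   ((a + b) * (a^-1 + b^-1) + (a * b / l + l) * ((a * b / l)^-1 + l^-1)) * u
   - ((a + b) * ((a * b / l)^-1 + l^-1) + (a^-1 + b^-1) * (a * b / l + l)) * v by [].
have e3 : ((a + b) * (a^-1 + b^-1)) * u =
   ((a + b) * (a * b / l)^-1 + (a^-1 + b^-1) * (a * b / l)) * v.
  apply/eqP; rewrite -subr_eq0; move/eqP: e1; rewrite -subr_eq0 => /eqP e1; apply/eqP.
  rewrite -[RHS]e1; field; by rewrite a0 b0 l0.
apply/eqP; rewrite -subr_eq0; apply/eqP.
(* The factor 2 arises because [l] and [a * b / l] contribute equally to the cross term, the
   conjugate of [a + b] being [(a + b) / (a * b)]. *)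
have : 2 * (((a + b) * (a^-1 + b^-1)) * u -
   ((a + b) * (a * b / l)^-1 + (a^-1 + b^-1) * (a * b / l)) * v) = 0 by rewrite e3 subrr mulr0.
move=> e4; apply: (mulfI (_ : -1 != 0)); first by rewrite oppr_eq0 oner_neq0.
rewrite mulr0 -[RHS]e4; field; by rewrite a0 b0 l0.
Qed.

End TwoBlock.

(** * Dimensions of eigenspaces *)

Section Necessity.
Variable C : numClosedFieldType.

Lemma rank_eigenspace_inv n (J2 J3 : 'M[C]_n) l : l != 0 ->
  is_symmetry J2 -> is_symmetry J3 ->
  (\rank (eigenspace (J2 *m J3) l) <= \rank (eigenspace (J2 *m J3) l^-1))%N.
Proof.
move=> l0 /symmetryP[_ J22] s3; have [_ J32] := (symmetryP J3).1 s3.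
have : eigenspace (J2 *m J3) l *m (J2 *m J3) = l *: eigenspace (J2 *m J3) l.
  exact/eigenspaceP.
move: (eigenspace _ l) => E EW; have EJ : E *m J3 *m J2 = l^-1 *: E.
  apply: (scalerI l0); rewrite scalerA divff // scale1r !scalemxAl -EW.
  by rewrite !mulmxA -[E *m J2 *m J3 *m J3]mulmxA J32 mulmx1 -mulmxA J22 mulmx1.
have [J3u _] := mulmx1_unit J32.
rewrite -(mxrankMfree E (B := J3)) ?row_free_unit //.
by apply/mxrankS/eigenspaceP; rewrite mulmxA EJ -scalemxAl.
Qed.

(** The rows of [1 + J] and [J - 1] lie in the eigenspaces of 1 and -1, and these matrices differ by
    2, so their ranks add up to at least [n]. *)
Lemma symmetry_large_eigenspace n (J : 'M[C]_n) : is_symmetry J ->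
  exists2 e : C, e ^+ 2 = 1 & (n <= (\rank (eigenspace J e)).*2)%N.
Proof.
move=> /symmetryP[_ J2].
have rk (e : C) : e ^+ 2 = 1 -> (\rank (e%:M + J)%R <= \rank (eigenspace J e))%N.
  move=> e2; apply/mxrankS/eigenspaceP; rewrite mulmxDl J2 mul_scalar_mx scalerDr.
  by rewrite addrC scale_scalar_mx -expr2 e2.
have : (n <= \rank (1%:M + J)%R + \rank ((-1)%:M + J)%R)%N.
  rewrite -[X in (X <= _)%N](mxrank1 C n) -(mxrank_opp ((-1)%:M + J)%R).
  have -> : \rank (1%:M : 'M[C]_n) = \rank ((1%:M + J) + - ((-1)%:M + J))%R.
    rewrite opprD addrACA subrr addr0 -raddfN /= opprK -raddfD /= -[in RHS]scalemx1.
    by rewrite eqmx_scale // -mulr2n pnatr_eq0.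
  exact: mxrank_add.
have r1 := rk 1 (expr1n _ _); have r2 : (-1) ^+ 2 = 1 :> C by rewrite sqrrN expr1n.
move=> le_n; have {le_n} := leq_trans le_n (leq_add r1 (rk _ r2)).
have [h _|h le_n] := leqP n (\rank (eigenspace J 1)).*2.
  by exists 1; rewrite ?expr1n.
by exists (-1) => //; move: h le_n; move: (\rank _) (\rank _) => p q; lia.
Qed.

Section BlockDiagonal.
Variables (r s : nat) (a b : C).
Let V : 'M[C]_(r + s) := block_mx a%:M 0 0 b%:M.

Lemma block_scalar_unitary : `|a| = 1 -> `|b| = 1 -> V \is unitarymx.
Proof.
move=> a1 b1; apply/unitarymxP; rewrite /V tr_block_mx map_block_mx !trmx0 !map_mx0.
rewrite !tr_scalar_mx !map_scalar_mx mulmx_block !mulmx0 !mul0mx !addr0 !add0r /=.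
by rewrite -!scalar_mxM -!normCK a1 b1 !expr1n -scalar_mx_block.
Qed.

Lemma block_scalar_quadratic : V *m V = (a + b) *: V - (a * b)%:M.
Proof.
rewrite /V mulmx_block !mulmx0 !mul0mx !addr0 !add0r -!scalar_mxM.
rewrite scale_block_mx !scaler0 !scale_scalar_mx [(a * b)%:M]scalar_mx_block.
rewrite opp_block_mx add_block_mx !oppr0 !addr0.
by congr block_mx; rewrite -raddfB /=; congr _%:M; ring.
Qed.

Lemma rank_eigenspace_block : (r <= \rank (eigenspace V a))%N.
Proof.
rewrite -[X in (X <= _)%N](mxrank1 C r).
have -> : \rank (1%:M : 'M[C]_r) = \rank (row_mx (1%:M : 'M[C]_r) (0 : 'M_(r, s))).
  by rewrite rank_row_mx0.
apply/mxrankS/eigenspaceP.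
rewrite mul_row_block !mulmx0 !mul0mx !addr0 mul1mx scale_row_mx scaler0.
by rewrite scale_scalar_mx mulr1.
Qed.

End BlockDiagonal.

Lemma sum_rank_eigenspace n (W : 'M[C]_n) m k (l : nat -> C) :
  {in gtn k &, injective l} ->
  (forall i, (i < k)%N -> (m <= \rank (eigenspace W (l i)))%N) -> (k * m <= n)%N.
Proof.
move=> inj hm.
have dir : mxdirect (\sum_(i < k) eigenspace W (l i)).
  by apply: mxdirect_sum_eigenspace => i j _ _ /inj h; apply/val_inj/h; rewrite inE /=.
have := rank_leq_col (\sum_(i < k) eigenspace W (l i))%MS.
rewrite (mxdirectP dir) /=; apply: leq_trans.
rewrite -[X in (X * _)%N](card_ord k) -sum_nat_const.
by apply: leq_sum => i _; apply: hm.
Qed.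

End Necessity.

(** * Condition (P) expressed through squares *)

Section ConditionPFacts.
Variables (C : numClosedFieldType) (r s : nat) (a b : C).
Hypothesis hP : ConditionP r s a b.

Lemma sqr1_pm1 (x : C) : (x ^+ 2 == 1) = (x \in [:: -1; 1]).
Proof. by rewrite sqrf_eq1 !inE orbC. Qed.

Lemma ConditionP_sqr : (a ^+ r * b ^+ s) ^+ 2 = 1.
Proof. by apply/eqP; rewrite sqr1_pm1; case: hP. Qed.

Lemma ConditionP_sqr_neq1 i j : (0 < i + j < r + s)%N -> (a ^+ i * b ^+ j) ^+ 2 != 1.
Proof.
move=> /andP[ij0 ijd]; rewrite sqr1_pm1; apply/negP => /(hP.2 i j) h.
suff : (r + s <= i + j)%N by rewrite leqNgt ijd.
by apply: h => -[i0 j0]; rewrite i0 j0 in ij0.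
Qed.

End ConditionPFacts.

(** * The chain of eigenvalues *)

Section Chain.
Variables (C : numClosedFieldType) (r s d0 : nat) (a b e : C).
Hypotheses (a1 : `|a| = 1) (b1 : `|b| = 1) (e2 : e ^+ 2 = 1).
Hypotheses (hP : ConditionP r s a b) (rsd : (r + s = d0.*2.+1)%N).

(* The eigenvalues of J V met when one starts from [e * a], the eigenvalue on
   ker (V - a) /\ ker (J - e), and applies inversion and l |-> - (a * b) / l
   alternately. *)
Definition chain k := (- (a * b)) ^+ k * (e * a).

Let a0 : a != 0 := unimodular_neq0 a1.
Let b0 : b != 0 := unimodular_neq0 b1.

Lemma chain_unimodular k : `|chain k| = 1.
Proof.
have e1 : `|e| = 1.
  by apply/eqP; rewrite -(pexpr_eq1 (n := 2)) // -normrX e2 normr1.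
by rewrite /chain !normrM normrX normrN normrM a1 b1 e1 !mulr1 expr1n.
Qed.

Lemma chainS k : chain k.+1 = - (a * b) * chain k.
Proof. by rewrite /chain exprS mulrA. Qed.

(** Squaring removes all signs and leaves a monomial to which (P) applies. *)
Lemma chain_sqr k : chain k ^+ 2 = (a ^+ k.+1 * b ^+ k) ^+ 2.
Proof.
rewrite [a ^+ _]exprS -mulrA -exprMn /chain [LHS]exprMn exprAC sqrrN exprAC [(e * a) ^+ 2]exprMn.
by rewrite e2 mul1r mulrC [RHS]exprMn.
Qed.

(** A coincidence would make [a ^+ k.+2 * b ^+ k] or [(a * b) ^+ k.+1] square to 1; their degree 2k
    + 2 is below [r + s]. *)
Lemma chain_inv_neq k : (k < d0)%N ->
  ((chain k)^-1 ^+ 2 != a ^+ 2) /\ ((chain k)^-1 ^+ 2 != b ^+ 2).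
Proof.
move=> kd; have c0 := unimodular_neq0 (chain_unimodular k).
have key x i j : x ^+ 2 * chain k ^+ 2 = (a ^+ i * b ^+ j) ^+ 2 ->
    (0 < i + j < r + s)%N -> (chain k)^-1 ^+ 2 != x ^+ 2.
  move=> xE ij; apply: contraNneq (ConditionP_sqr_neq1 hP ij) => cx.
  by rewrite -xE -cx -exprMn mulVf // expr1n.
split; [apply: (key _ k.+2 k)|apply: (key _ k.+1 k.+1)]; rewrite ?rsd; try lia.
  by rewrite chain_sqr -exprMn mulrA -exprS.
by rewrite chain_sqr -exprMn mulrCA -exprS.
Qed.

(** Equal terms at i < j would make [(a * b) ^+ (j - i)] square to 1, in degree at most 2 d0 <
    [r + s]. *)
Lemma chain_inj : {in gtn d0.+1 &, injective chain}.
Proof.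
have c0 k := unimodular_neq0 (chain_unimodular k).
suff H i j : (i < j)%N -> (j <= d0)%N -> chain i != chain j.
  move=> i j; rewrite !inE /= !ltnS => hi hj; have [ij|ij|//] := ltngtP i j => /eqP h.
    by rewrite (negPf (H i j _ _)) in h.
  by rewrite eq_sym (negPf (H j i _ _)) in h.
move=> ij jd; have ne1 : (a ^+ (j - i) * b ^+ (j - i)) ^+ 2 != 1.
  by apply: (ConditionP_sqr_neq1 hP); rewrite rsd; lia.
apply: contraNneq ne1 => cij; have : chain j = (- (a * b)) ^+ (j - i) * chain i.
  by rewrite /chain mulrA -exprD subnK // ltnW.
rewrite -cij -[LHS]mul1r => /(mulIf (c0 i)) h.
by rewrite -exprMn exprAC -sqrrN exprAC -h expr1n.
Qed.

(* Condition (P)(i) gives [(a * b) ^+ d0.*2 * a ^+ 2 = 1], which eliminates the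
   isolated factor [a ^+ 2] of [chain k ^+ 2]. *)
Lemma chain_gapE k : r = d0.+1 -> (k < d0)%N ->
  `|(chain k)^-1 - a * b * chain k| = `|1 - (a * b) ^+ (d0 - k).*2.-1|.
Proof.
move=> rE kd; have sE : s = d0 by move: rsd; rewrite rE; lia.
set c := chain k; have c0 : c != 0 := unimodular_neq0 (chain_unimodular k).
set z := (a * b) ^+ _.
have cz : a * b * c ^+ 2 * z = 1.
  rewrite /c chain_sqr // /z -[RHS](ConditionP_sqr hP) rE sE.
  have h i : a ^+ i.+1 * b ^+ i = a * (a * b) ^+ i by rewrite exprMn exprS mulrA.
  rewrite !h; move: (a * b) => p; rewrite !exprMn -!exprM mulrCA -!mulrA; congr (_ * _).
  by rewrite -exprD -exprS; congr (_ * _ ^+ _); lia.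
have -> : 1 - z = - (c * z) * (c^-1 - a * b * c) by rewrite -cz; field.
rewrite normrM normrN normrM chain_unimodular mul1r [`|z|]normrX normrM a1 b1.
by rewrite mulr1 expr1n mul1r.
Qed.

End Chain.

(** * Necessity: counting dimensions along the chain *)

Section NecessityMain.
Variables (C : numClosedFieldType) (r s d0 : nat) (a b : C).
Hypotheses (a1 : `|a| = 1) (b1 : `|b| = 1).
Hypotheses (hP : ConditionP r s a b) (rsd : (r + s = d0.*2.+1)%N) (sr : (s < r)%N).
Let V : 'M[C]_(r + s) := block_mx a%:M 0 0 b%:M.

Lemma Sym3_necessary : Sym 3 V -> r = d0.+1 /\
  exists2 e : C, e ^+ 2 = 1 & forall k, (k < d0)%N ->
    `|(chain a b e k)^-1 - a * b * chain a b e k| < `|a - b|.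
Proof.
case/Sym3P => J1 [J2 [J3 [s1 s2 s3 VE]]].
have [_ J12] := (symmetryP J1).1 s1.
have [e e2 he] := symmetry_large_eigenspace s1.
have uV : V \is unitarymx := block_scalar_unitary r s a1 b1.
have qV := block_scalar_quadratic r s a b : V *m V = _.
have WE : J1 *m V = J2 *m J3 by rewrite VE !mulmxA J12 mul1mx.
have c1 := chain_unimodular a1 b1 e2.
have c0 k := unimodular_neq0 (c1 k).
set m := \rank (eigenspace V a :&: eigenspace J1 e)%MS.
(* As the dimension is odd, the large eigenspace of [J1] has dimension at least d0 + 1. *)
have rm : (r + d0.+1 <= m + d0.*2.+1)%N.
  have := mxrank_sum_cap (eigenspace V a) (eigenspace J1 e).
  have := rank_eigenspace_block r s a b; rewrite -/V.
  have := rank_leq_col (eigenspace V a + eigenspace J1 e)%MS.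
  move: he; rewrite -/m; move: rsd => h1 h2 h3 h4 h5.
  by lia.
have inv k : (\rank (eigenspace (J1 *m V) (chain a b e k)) <=
              \rank (eigenspace (J1 *m V) (chain a b e k)^-1))%N.
  by rewrite WE; apply: rank_eigenspace_inv.
have mrk k : (k <= d0)%N -> (m <= \rank (eigenspace (J1 *m V) (chain a b e k)))%N.
  elim: k => [_|k IH kd].
    apply: mxrankS; apply/eigenspaceP.
    set U := (_ :&: _)%MS.
    have /eigenspaceP UV : (U <= eigenspace V a)%MS by apply: capmxSl.
    have /eigenspaceP UJ : (U <= eigenspace J1 e)%MS by apply: capmxSr.
    by rewrite /chain mul1r mulmxA UJ -scalemxAl UV scalerA.
  apply: leq_trans (IH (ltnW kd)) _; apply: leq_trans (inv k) _.
  have [la lb] := chain_inv_neq a1 b1 e2 hP rsd kd.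
  rewrite chainS -[chain a b e k in X in (_ <= X)%N]invrK.
  by apply: rank_eigenspace_transfer; rewrite ?invr_eq0.
(* The d0 + 1 independent eigenspaces give (d0 + 1) m <= 2 d0 + 1, so m <= 1, whereas r - d0 <= m
   and r > d0. *)
have rE : r = d0.+1.
  have := sum_rank_eigenspace (chain_inj a1 b1 e2 hP rsd) mrk.
  by move: sr rm rsd; clear; move: m => p; nia.
split=> //; exists e => // k kd.
have [la lb] := chain_inv_neq a1 b1 e2 hP rsd kd.
have rk0 : (0 < \rank (eigenspace (J1 *m V) (chain a b e k)^-1))%N.
  apply: leq_trans (inv k); apply: leq_trans (mrk k (ltnW kd)).
  by move: rm; rewrite rE; lia.
have /rowV0Pn[y /eigenspaceP yE y0] : eigenspace (J1 *m V) (chain a b e k)^-1 != 0.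
  by rewrite -mxrank_eq0 -lt0n.
rewrite -[chain a b e k in X in _ - X]invrK.
by apply: (eigen_gap a1 b1 s1 uV qV _ la lb y0); rewrite ?normfV ?c1 ?invr1 // -mulmxA.
Qed.

End NecessityMain.

(** * Unitary similarity and spectra with two values *)

Section UnitaryConjugation.
Variable C : numClosedFieldType.

Lemma perm_mx_unitary n (p : 'S_n) : (perm_mx p : 'M[C]_n) \is unitarymx.
Proof.
by apply/unitarymxP; rewrite tr_perm_mx map_perm_mx -perm_mxM mulgV perm_mx1.
Qed.

Lemma symmetry_conj n (P J : 'M[C]_n) : P \is unitarymx -> is_symmetry J ->
  is_symmetry (P *m J *m P^t*).
Proof.
move=> uP /symmetryP[JJ J2]; apply/symmetryP; split.
  by rewrite !adjM trmxCK JJ mulmxA.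
by rewrite !mulmxA mulmxKtV // -[P *m J *m J]mulmxA J2 mulmx1 (unitarymxP uP).
Qed.

Lemma Sym3_conj n (P A : 'M[C]_n) : P \is unitarymx -> Sym 3 A ->
  Sym 3 (P *m A *m P^t*).
Proof.
move=> uP /Sym3P[J1 [J2 [J3 [s1 s2 s3 ->]]]]; apply/Sym3P.
exists (P *m J1 *m P^t*), (P *m J2 *m P^t*), (P *m J3 *m P^t*).
split; try exact: symmetry_conj.
by rewrite !mulmxA !mulmxKtV.
Qed.

Lemma diag_mx_permuted n (u v : 'rV[C]_n) :
  perm_eq (codom (u 0)) (codom (v 0)) ->
  exists2 P : 'M[C]_n, P \is unitarymx & diag_mx u = P *m diag_mx v *m P^t*.
Proof.
rewrite (_ : codom (v 0) = [tuple v 0 i | i < n] :> seq C); last by [].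
case/tuple_permP => p uE; exists (perm_mx p); first exact: perm_mx_unitary.
have up i : u 0 i = v 0 (p i).
  have := congr1 (fun s => nth 0 s i) uE.
  rewrite (nth_map i) ?size_enum_ord // nth_ord_enum => ->.
  by rewrite -tnth_nth !tnth_mktuple.
apply/matrixP=> i j; rewrite tr_perm_mx map_perm_mx -row_permE.
rewrite -[perm_mx _]/(perm_mx (p^-1)%g) -col_permE !mxE up.
by rewrite (inj_eq perm_inj).
Qed.

Lemma sum_two_valued (a b : C) (t : seq C) : all (pred2 a b) t ->
  \sum_(x <- t) x = (count_mem a t)%:R * (a - b) + (size t)%:R * b.
Proof.
elim: t => [|x t IH] /=; first by rewrite big_nil !mul0r addr0.
case/andP=> xab /IH tE; rewrite big_cons tE; have [->|xa] := eqVneq x a.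
  by rewrite natrD mulr1n -[(size t).+1%:R]natr1; ring.
by move: xab; rewrite (negPf xa) /= => /eqP ->; rewrite -[(size t).+1%:R]natr1 add0n; ring.
Qed.

(** Since [a != b], length and sum determine the multiplicity of [a]. *)
Lemma perm_two_valued (a b : C) (t u : seq C) : a != b ->
  all (pred2 a b) t -> all (pred2 a b) u -> size t = size u ->
  \sum_(x <- t) x = \sum_(x <- u) x -> perm_eq t u.
Proof.
move=> ab ht hu tu; rewrite !(@sum_two_valued a b) // tu => /addIr.
move/mulIf; rewrite subr_eq0 => /(_ ab)/eqP; rewrite eqr_nat => /eqP cntE.
have cntb w : all (pred2 a b) w -> (count_mem a w + count_mem b w = size w)%N.
  elim: w => //= x w IH /andP[/orP[]/eqP -> /IH <-]; rewrite eqxx ?(negPf ab); first by lia.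
  by rewrite eq_sym (negPf ab); lia.
apply/allP => x; rewrite mem_cat => xtu.
have /orP : pred2 a b x by case/orP: xtu; [move/allP: ht|move/allP: hu]; apply.
case=> /eqP ->; first by rewrite /= cntE.
apply/eqP/(@addnI (count_mem a u)).
by rewrite -[in LHS]cntE !cntb.
Qed.

(** By the spectral theorem [A] is unitarily diagonal; the quadratic confines its eigenvalues to [a]
    and [b], and the trace fixes their multiplicities. *)
Lemma quadratic_unitary_similar r s (a b : C) (A : 'M[C]_(r + s)) :
  a != b -> A \is unitarymx -> A *m A = (a + b) *: A - (a * b)%:M ->
  \tr A = r%:R * a + s%:R * b ->
  exists2 P : 'M[C]_(r + s), P \is unitarymx &
    block_mx a%:M 0 0 b%:M = P *m A *m P^t*.
Proof.
move=> ab uA qA trA.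
have nA : A \is normalmx.
  apply/normalmxP; rewrite (unitarymxP uA).
  by rewrite -(invmx_unitary uA) mulVmx // unitarymx_unit.
have uP := spectral_unitarymx A; set P := spectralmx A in uP.
have AE : A = P^t* *m diag_mx (spectral_diag A) *m P.
  by rewrite {1}(orthomx_spectralP nA) invmx_unitary.
move: (spectral_diag A) AE => v AE.
have vE : diag_mx v = P *m A *m P^t*.
  by rewrite AE !mulmxA (unitarymxP uP) mul1mx mulmxtVK.
have vab i : (v 0 i == a) || (v 0 i == b).
  have : diag_mx v *m diag_mx v = (a + b) *: diag_mx v - (a * b)%:M.
    rewrite vE !mulmxA mulmxKtV // -[P *m A *m A]mulmxA qA mulmxBr mulmxBl.
    rewrite -!scalemxAr -!scalemxAl mul_mx_scalar -scalemxAl (unitarymxP uP).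
    by rewrite scalemx1.
  move/matrixP/(_ i i); rewrite mul_diag_mx !mxE eqxx !mulr1n => /eqP.
  rewrite -subr_eq0 (_ : _ - _ = (v 0 i - a) * (v 0 i - b)); last by ring.
  by rewrite mulf_eq0 !subr_eq0.
have VE : block_mx a%:M 0 0 b%:M = diag_mx (row_mx (const_mx a) (const_mx b) : 'rV[C]_(r + s)).
  by rewrite diag_mx_row !diag_const_mx.
have sumE (u : 'rV[C]_(r + s)) : \sum_(x <- codom (u 0)) x = \tr (diag_mx u).
  rewrite /codom /image_mem big_map big_enum /=.
  by apply: eq_bigr => i _; rewrite mxE eqxx.
have [|Q uQ QE] := @diag_mx_permuted _ (row_mx (const_mx a) (const_mx b)) v.
  apply: (perm_two_valued ab).
  - apply/allP => _ /codomP[i ->]; rewrite mxE; case: splitP => j _; rewrite mxE /=.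
      by rewrite eqxx.
    by rewrite eqxx orbT.
  - by apply/allP => _ /codomP[i ->]; apply: vab.
  - by rewrite !size_codom.
  rewrite !sumE -VE vE mxtrace_block !mxtrace_scalar mxtrace_mulC mulmxA.
  by rewrite -(invmx_unitary uP) mulVmx ?unitarymx_unit // mul1mx trA !mulr_natl.
exists (Q *m P); first exact: mul_unitarymx.
by rewrite VE QE vE adjM !mulmxA.
Qed.

End UnitaryConjugation.

(** * Matrices adapted to an involution of the indices *)

Section CrossMatrix.
Variables (C : numClosedFieldType) (n : nat) (t : 'I_n -> 'I_n).
Hypothesis tK : involutive t.

(* In the basis ordered along the orbits of [t], block diagonal with blocks of
   size 1 and 2. *)
Definition crossmx (c s : 'I_n -> C) : 'M[C]_n :=
  \matrix_(i, j) (c i *+ (j == i) + s i *+ (j == t i)).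

Lemma mul_crossmx c s (B : 'M[C]_n) i k :
  (crossmx c s *m B) i k = c i * B i k + s i * B (t i) k.
Proof.
rewrite mxE; under eq_bigr do rewrite mxE mulrDl.
rewrite big_split /= (bigD1 i) //= eqxx mulr1n big1 => [|j /negPf->]; last first.
  by rewrite mulr0n mul0r.
rewrite addr0 (bigD1 (t i)) //= eqxx mulr1n big1 ?addr0 // => j /negPf->.
by rewrite mulr0n mul0r.
Qed.

Lemma crossmx_symmetry c s :
  (forall i, (c i)^* = c i) -> (forall i, (s (t i))^* = s i) ->
  (forall i, c i ^+ 2 + s i * s (t i) = 1) ->
  (forall i, s i * (c i + c (t i)) = 0) -> is_symmetry (crossmx c s).
Proof.
move=> cR sR cs1 cs0; apply/symmetryP; split; apply/matrixP=> i j.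
  rewrite !mxE rmorphD !rmorphMn /= cR [i == t j]eq_sym (inv_eq tK) [i == j]eq_sym.
  congr (_ + _).
    by case: eqP => [->|].
  by case: eqP => // ->; rewrite sR.
rewrite mul_crossmx !mxE tK [i == j]eq_sym.
transitivity ((c i ^+ 2 + s i * s (t i)) *+ (j == i)  + s i * (c i + c (t i)) *+ (j == t i)).
  by case: (j == i); case: (j == t i); rewrite ?mulr1n ?mulr0n; ring.
by rewrite cs1 cs0 mul0rn addr0.
Qed.

(** Cayley-Hamilton blockwise: where [s] does not vanish, a block of size 2 has trace [a + b] and
    determinant [a * b]. *)
Lemma crossmx_quadratic c s (a b : C) :
  (forall i, c i ^+ 2 + s i * s (t i) = (a + b) * c i - a * b) ->
  (forall i, s i * (c i + c (t i)) = (a + b) * s i) ->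
  crossmx c s *m crossmx c s = (a + b) *: crossmx c s - (a * b)%:M.
Proof.
move=> cs1 cs0; apply/matrixP=> i j; rewrite mul_crossmx !mxE tK [i == j]eq_sym.
transitivity ((c i ^+ 2 + s i * s (t i)) *+ (j == i)  + s i * (c i + c (t i)) *+ (j == t i)).
  by case: (j == i); case: (j == t i); rewrite ?mulr1n ?mulr0n; ring.
rewrite cs0 cs1; by case: (j == i); case: (j == t i); rewrite ?mulr1n ?mulr0n; ring.
Qed.

Lemma crossmx_diag c s (w : 'I_n -> C) :
  crossmx c s *m diag_mx (\row_i w i) =
  crossmx (fun i => c i * w i) (fun i => s i * w (t i)).
Proof.
apply/matrixP=> i j; rewrite mul_crossmx !mxE ![_ == j]eq_sym.
by rewrite !mulrnAr.
Qed.

(** For unimodular [w] with [w (t i) = (w i)^-1] both factors are symmetries, which realises a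
    prescribed spectrum as [J2 *m J3]. *)
Lemma crossmx_antidiag (w : 'I_n -> C) :
  crossmx (fun=> 0) w *m crossmx (fun=> 0) (fun=> 1) = diag_mx (\row_i w i).
Proof.
apply/matrixP=> i j; rewrite mul_crossmx !mxE tK mul0r !mul0rn !add0r [i == j]eq_sym.
by rewrite mulrnAr mulr1.
Qed.

End CrossMatrix.

(** * The cosine of a plane reflection *)

Section Rotation.
Variables (C : numClosedFieldType) (a b l1 l2 : C).
Hypotheses (a1 : `|a| = 1) (b1 : `|b| = 1) (l11 : `|l1| = 1) (l21 : `|l2| = 1).
Hypotheses (prod12 : l1 * l2 = - (a * b)) (gap : `|l1 + l2| < `|a - b|).

Let gap' : `|a + b| < `|l1 - l2|.
Proof. by rewrite -ltr_normC_diff. Qed.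

Lemma gap_neq0 : l1 - l2 != 0.
Proof. by rewrite -normr_gt0; apply: le_lt_trans gap'. Qed.

(* [c = (a + b) / (l1 - l2)] is the cosine for which the reflection
   ((c, s), (s, -c)) times diag(l1, l2) has eigenvalues [a] and [b]. *)
Lemma rotation_real : ((a + b) / (l1 - l2))^* = (a + b) / (l1 - l2).
Proof.
have [a0 b0] := (unimodular_neq0 a1, unimodular_neq0 b1).
have [l10 l20] := (unimodular_neq0 l11, unimodular_neq0 l21).
have l120 := gap_neq0.
have l210 : l2 - l1 != 0 by rewrite -opprB oppr_eq0.
rewrite rmorphM fmorphV rmorphB rmorphD /= !conjC_unimodular //.
(* Conjugation divides both [a + b] and [l1 - l2] by [a * b], so the quotient is real. *)
have -> : a^-1 + b^-1 = - (a + b) / (l1 * l2).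
  by rewrite prod12; field; rewrite a0 b0.
by field; rewrite mulN1r l10 l20 l120 l210.
Qed.

Lemma rotation_sqr_lt1 : ((a + b) / (l1 - l2)) ^+ 2 < 1.
Proof.
have -> : ((a + b) / (l1 - l2)) ^+ 2 = `|(a + b) / (l1 - l2)| ^+ 2.
  by rewrite normCK rotation_real expr2.
rewrite expr_lt1 // normrM normfV ltr_pdivrMr ?mul1r //.
by apply: le_lt_trans gap'.
Qed.

End Rotation.

(** * Sufficiency: construction of the three symmetries *)

Section Sufficiency.
Variables (C : numClosedFieldType) (n d0 : nat) (a b : C).
Hypotheses (a1 : `|a| = 1) (b1 : `|b| = 1) (ab : a != b) (nE : n = d0.*2.+1).
Hypothesis chain_gap : forall k, (k < d0)%N ->
  `|(chain a b 1 k)^-1 - a * b * chain a b 1 k| < `|a - b|.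
Hypothesis chain_end : chain a b 1 d0 ^+ 2 = 1.

(* The spectrum of [J2 *m J3] is w, listed so that [sigma] pairs conjugate
   entries and [tau] (which fixes 0, as [0.-1 = 0]) pairs entries of product
   [- (a * b)]; [J1] rotates each [tau]-pair. *)
Let sigma i := if i == d0.*2 then i else if odd i then i.-1 else i.+1.
Let tau i := if odd i then i.+1 else i.-1.
Let w i : C := if odd i then (chain a b 1 i./2)^-1 else chain a b 1 i./2.
Let cs i : C := if i == 0%N then 1 else (a + b) / (w i - w (tau i)).
Let sn i : C := sqrtC (1 - cs i ^+ 2).

Let tauK : involutive tau.
Proof. by rewrite /tau => -[|i] //; case: ifP; case: ifP => /=; lia. Qed.

Let sigmaK i : (i < n)%N -> sigma (sigma i) = i.
Proof.
rewrite nE /sigma; have [->|] := eqVneq i d0.*2; first by rewrite eqxx.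
by case: i => [|i]; do ?case: ifP => /=; lia.
Qed.

Let sigma_lt i : (i < n)%N -> (sigma i < n)%N.
Proof. by rewrite nE /sigma; do ?case: ifP => /=; lia. Qed.

Let tau_lt i : (i < n)%N -> (tau i < n)%N.
Proof. by rewrite nE /tau; do ?case: ifP => /=; lia. Qed.

Let c1 k : `|chain a b 1 k| = 1.
Proof. by apply: chain_unimodular; rewrite ?expr1n. Qed.

Let w1 i : `|w i| = 1.
Proof. by rewrite /w; case: ifP; rewrite ?normfV c1 ?invr1. Qed.

Let w_sigma i : (i < n)%N -> w (sigma i) = (w i)^-1.
Proof.
rewrite nE /sigma; have [->|ne] := eqVneq i d0.*2.
  (* The unpaired last entry is its own inverse by [chain_end]. *)
  move=> _; rewrite /w odd_double doubleK.
  apply: (mulIf (unimodular_neq0 (c1 d0))); rewrite -expr2 chain_end mulVf //.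
  exact: unimodular_neq0.
rewrite /w; case oi: (odd i) => ilt.
  have -> : odd i.-1 = false by lia.
  by rewrite invrK; congr chain; lia.
have -> : odd i.+1 by lia.
by congr (chain _ _ _ _)^-1; lia.
Qed.

Let w_tau i : (0 < i < n)%N ->
  w i * w (tau i) = - (a * b) /\ `|w i + w (tau i)| < `|a - b|.
Proof.
have main k : (k < d0)%N -> w k.*2.+1 * w k.*2.+2 = - (a * b) /\
    `|w k.*2.+1 + w k.*2.+2| < `|a - b|.
  move=> kd; have c0 := unimodular_neq0 (c1 k).
  rewrite /w /= odd_double /= doubleK uphalf_double chainS mulNr.
  by split; [field | apply: chain_gap].
rewrite nE /tau => ilt; case: ifP => oi.
  have -> : i = (i./2).*2.+1 by lia.
  by apply: main; lia.
rewrite mulrC addrC; have -> : i = (i.-1./2).*2.+2 by lia.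
by apply: main; lia.
Qed.

Let cs_real i : (i < n)%N -> (cs i)^* = cs i.
Proof.
case: i => [_|i ilt]; first by rewrite /cs /= rmorph1.
by have [p g] := @w_tau i.+1 ilt; apply: rotation_real.
Qed.

(** This makes the sine [sn] real, hence [J1] self-adjoint. *)
Let cs_sqr i : (i < n)%N -> cs i ^+ 2 <= 1.
Proof.
case: i => [_|i ilt]; first by rewrite /cs /= expr1n.
by have [p g] := @w_tau i.+1 ilt; apply/ltW/rotation_sqr_lt1.
Qed.

Let cs_tau i : cs (tau i.+1) = - cs i.+1.
Proof.
rewrite /cs tauK; have -> : (tau i.+1 == 0)%N = false by rewrite /tau; case: ifP => /=; lia.
by rewrite /= -mulrN -invrN opprB.
Qed.

(** At the fixed point 0 of [tau] the block has size 1; since [w 0 = a], it supplies the eigenvalue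
    [a] beyond the d0 pairs. *)
Let cs0 : cs 0 = 1. Proof. by []. Qed.
Let sn0 : sn 0 = 0. Proof. by rewrite /sn cs0 expr1n subrr sqrtC0. Qed.

Let sn_tau i : sn (tau i) = sn i.
Proof. by case: i => [|i] //; rewrite /sn cs_tau sqrrN. Qed.

Let sn_real i : (i < n)%N -> (sn i)^* = sn i.
Proof. by move=> ilt; apply/conj_Creal/ger0_real; rewrite sqrtC_ge0 subr_ge0 cs_sqr. Qed.

Let cs_mul i : (0 < i < n)%N -> cs i * (w i - w (tau i)) = a + b.
Proof.
move=> ilt; have [p g] := w_tau ilt; rewrite /cs.
have -> : (i == 0)%N = false by lia.
by rewrite divfK // (@gap_neq0 _ a b).
Qed.

Let ord_sigma (i : 'I_n) : 'I_n := Ordinal (sigma_lt (ltn_ord i)).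
Let ord_tau (i : 'I_n) : 'I_n := Ordinal (tau_lt (ltn_ord i)).
Let ord_sigmaK : involutive ord_sigma.
Proof. by move=> i; apply/val_inj/sigmaK. Qed.
Let ord_tauK : involutive ord_tau.
Proof. by move=> i; apply/val_inj/tauK. Qed.

Let J1 : 'M[C]_n := crossmx ord_tau cs sn.
Let J2 : 'M[C]_n := crossmx ord_sigma (fun=> 0) w.
Let J3 : 'M[C]_n := crossmx ord_sigma (fun=> 0) (fun=> 1).

Let sJ1 : is_symmetry J1.
Proof.
apply: crossmx_symmetry => // -[i ilt] /=.
- exact: cs_real.
- by rewrite sn_tau sn_real.
- by rewrite sn_tau -expr2 sqrtCK addrC subrK.
by case: i ilt => [|i] ilt; rewrite ?sn0 ?mul0r // cs_tau subrr mulr0.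
Qed.

Let sJ2 : is_symmetry J2.
Proof.
have w0 i := unimodular_neq0 (w1 i).
apply: crossmx_symmetry => // -[i ilt] /=; rewrite ?rmorph0 //.
- by rewrite conjC_unimodular // w_sigma // invrK.
- by rewrite w_sigma // divff // expr0n add0r.
by rewrite addr0 mulr0.
Qed.

Let sJ3 : is_symmetry J3.
Proof.
apply: crossmx_symmetry => // i /=; rewrite ?rmorph0 ?rmorph1 //.
  by rewrite mulr1 expr0n add0r.
by rewrite addr0 mulr0.
Qed.

Let A := J1 *m J2 *m J3.

Let AE : A = crossmx ord_tau (fun i => cs i * w i) (fun i => sn i * w (tau i)).
Proof. by rewrite /A -mulmxA crossmx_antidiag // crossmx_diag. Qed.

(** On a [tau]-pair with entries x, y of [w], cosine c and sine s, the block of [A] has trace c (x -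
    y) = a + b and determinant - (c^2 + s^2) x y = a b. *)
Let A_quadratic : A *m A = (a + b) *: A - (a * b)%:M.
Proof.
have w00 : w 0 = a by rewrite /w /chain /= expr0 !mul1r.
rewrite AE; apply: crossmx_quadratic => // -[[|i] ilt] /=.
- by rewrite sn0 cs0 w00; ring.
- rewrite sn_tau tauK; have /= cm := @cs_mul i.+1 ilt.
  have [/= p _] := @w_tau i.+1 ilt; rewrite -cm.
  have sc : sn i.+1 ^+ 2 = 1 - cs i.+1 ^+ 2 by rewrite sqrtCK.
  rewrite -[X in _ - X]opprK -p; move: sc.
  set x := w i.+1; set y := w _; set c := cs _; set s := sn _ => sc.
  have -> : s * y * (s * x) = s ^+ 2 * (x * y) by ring.
  by rewrite sc; ring.
- by rewrite sn0 !mul0r mulr0.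
have /= <- := @cs_mul i.+1 ilt; rewrite cs_tau; ring.
Qed.

Let trA : \tr A = d0.+1%:R * a + d0%:R * b.
Proof.
have w00 : w 0 = a by rewrite /w /chain /= expr0 !mul1r.
have -> : \tr A = \sum_(0 <= i < n) cs i * w i.
  rewrite big_mkord; apply: eq_bigr => -[[|i] ilt] _; rewrite AE mxE eqxx mulr1n.
    by rewrite /= sn0 mul0r mul0rn addr0.
  rewrite (_ : _ == _ = false) ?mulr0n ?addr0 //.
  by apply/eqP => /(congr1 val) /=; rewrite /tau; case: ifP => /=; lia.
(* Index 0 contributes [a], and each [tau]-pair contributes [a + b]. *)
rewrite nE; suff sumE k : (k <= d0)%N ->
    \sum_(0 <= i < k.*2.+1) cs i * w i = k.+1%:R * a + k%:R * b by exact: sumE.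
elim: k => [|k IH] kd.
  by rewrite big_nat1 cs0 w00 mul0r addr0.
rewrite doubleS big_nat_recr //= big_nat_recr //= (IH (ltnW kd)).
have /cs_mul : (0 < k.*2.+1 < n)%N by lia.
have /= := cs_tau k.*2; rewrite /tau /= odd_double /= => ->.
rewrite -[k.+2%:R]natr1 -natr1 mulNr -addrA -mulrBr => ->; ring.
Qed.

Lemma Sym3_sufficient r s : n = (r + s)%N -> r = d0.+1 -> s = d0 ->
  Sym 3 (block_mx a%:M 0 0 b%:M : 'M[C]_(r + s)).
Proof.
move=> nrs rE sE; have SA : Sym 3 A by apply/Sym3P; exists J1, J2, J3.
have uA : A \is unitarymx by rewrite !mul_unitarymx // symmetry_unitary.
(* Generalising [A] allows its size [n] to be rewritten as [r + s]. *)
move: A SA uA A_quadratic trA; rewrite nrs => B SB uB qB trB.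
have [|P uP ->] := quadratic_unitary_similar ab uB qB; first by rewrite trB rE sE.
exact: Sym3_conj.
Qed.

End Sufficiency.

Theorem theorem3p11 (R : realType) (d r s : nat) (alpha beta : R[i])
    (hd3 : (3 <= d)%N) (hdodd : odd d)
    (hd : d = (r + s)%N) (hs : (1 <= s)%N) (hsr : (s < r)%N)
    (halpha : `|alpha| = 1) (hbeta : `|beta| = 1) (hneq : alpha <> beta)
    (hP : ConditionP r s alpha beta) :
  let d0 := ((d - 1) %/ 2)%N in
  let V : 'M[R[i]]_(r + s) := block_mx alpha%:M 0 0 beta%:M in
  Sym 3 V <->
  [/\ r = (d0 + 1)%N, s = d0 &
      forall j : nat, (1 <= j <= d0)%N ->
        `|1 - (alpha * beta) ^+ (2 * j - 1)| < `|alpha - beta|].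
Proof.
move=> d0 V; have rsd : (r + s = d0.*2.+1)%N by rewrite -hd /d0; lia.
split=> [SV|[rE sE gap]].
  have [rE [e e2 gap]] := Sym3_necessary halpha hbeta hP rsd hsr SV.
  split; [by rewrite addn1|lia|] => j /andP[j1 jd].
  (* The chain index d0 - j corresponds to the exponent 2j - 1. *)
  have kd : (d0 - j < d0)%N by lia.
  have -> : (2 * j - 1 = (d0 - (d0 - j)).*2.-1)%N by lia.
  by rewrite -(chain_gapE halpha hbeta e2 hP rsd rE kd) gap.
have r1 : r = d0.+1 by rewrite rE addn1.
apply: (@Sym3_sufficient _ (r + s) d0) => //; first exact/eqP.
  move=> k kd; rewrite (chain_gapE halpha hbeta (expr1n _ _) hP rsd r1 kd).
  have -> : ((d0 - k).*2.-1 = 2 * (d0 - k) - 1)%N by lia.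
  by apply: gap; lia.
(* Condition (P)(i) closes the chain: its last term squares to 1. *)
by rewrite chain_sqr ?expr1n // -[RHS](ConditionP_sqr hP) r1 sE.
Qed.
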